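(* $$\big\|\mathrm{Cov}(\hat{\mathcal{I}}_1(\theta))\big\|_\infty\le\frac1N\|\partial h_L(x)\|_\infty^4\,\big\|\mathcal{K}(t)-\mathcal{I}(h_L)\otimes\mathcal{I}(h_L)\big\|_1,$$ and, if $\sigma\in C^2(\mathbb{R})$, $$\big\|\mathrm{Cov}(\hat{\mathcal{I}}_2(\theta))\big\|_\infty\le\frac1N\|\partial^2h_L(x)\|_\infty^2\,\|\mathcal{I}(h_L)\|_1 .$$
   Context: Setup. Fix an input $x\in\mathbb{R}^{n_0}$ and integers $L\ge1$, $n_1,\dots,n_L\ge1$. Network. The parameters are $\theta=(W_0,\dots,W_{L-1})$, with $W_l\in\mathbb{R}^{n_{l+1}\times(n_l+1)}$, viewed as a vector in $\mathbb{R}^{\dim\theta}$. Let $\sigma$ be differentiable and applied entrywise. Set $h_0=x$ and $\bar h_l=(h_l^\top,1)^\top$. For $1\le l\le L-1$ let $h_l=\sigma(W_{l-1}\bar h_{l-1})$, and let $h_L=W_{L-1}\bar h_{L-1}\in\mathbb{R}^{n_L}$. Exponential family. The model is $p(y\mid x,\theta)=\exp(t(y)^\top h_L-F(h_L))$ with respect to a base measure $\nu$, where $t(y)\in\mathbb{R}^{n_L}$ and $F(h)=\log\int\exp(t(y)^\top h)\,d\nu(y)$. Assume $h_L$ lies in the interior of the natural parameter space. Let $\eta=\mathbb{E}[t(y)]$ and $\mathcal{I}(h_L)=\mathrm{Cov}(t(y))$, with $y\sim p(y\mid x,\theta)$. Estimators. With $N$ i.i.d. samples $y_i\sim p(y\mid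 x,\theta)$ and $\ell_i=\log p(y_i\mid x,\theta)$, let $\hat{\mathcal{I}}_1(\theta)=\frac1N\sum_i\frac{\partial\ell_i}{\partial\theta}\frac{\partial\ell_i}{\partial\theta^\top}$ and $\hat{\mathcal{I}}_2(\theta)=\frac1N\sum_i(-\frac{\partial^2\ell_i}{\partial\theta\partial\theta^\top})$. Notation. $\mathrm{Cov}(\hat{\mathcal{I}})$ is the 4-tensor with entries $\mathrm{Cov}(\hat{\mathcal{I}}^{ij},\hat{\mathcal{I}}^{kl})$. $\partial h_L$ is the $n_L\times\dim\theta$ Jacobian and $\partial^2h_L$ the $n_L\times\dim\theta\times\dim\theta$ tensor of second derivatives with respect to $\theta$. $\mathcal{K}_{abcd}(t)=\mathbb{E}[(t_a-\eta_a)(t_b-\eta_b)(t_c-\eta_c)(t_d-\eta_d)]$ and $(\mathcal{I}\otimes\mathcal{I})_{abcd}=\mathcal{I}_{ab}\mathcal{I}_{cd}$. For a tensor, $\|\cdot\|_\infty$ is the maximum absolute entry and $\|\cdot\|_1$ the sum of absolute entries. *)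

(* Defs.v *)
From mathcomp Require Import all_boot all_order all_algebra.
From mathcomp Require Import all_classical all_reals all_analysis.
Import Order.TTheory GRing.Theory Num.Theory.
Import numFieldNormedType.Exports.

Set Implicit Arguments.
Unset Strict Implicit.
Unset Printing Implicit Defensive.

Local Open Scope classical_set_scope.
Local Open Scope ring_scope.

(* Network parameters.  Layer widths are n 0 (= n_0), n 1, ..., n L.       *)
(* theta = (W_0, ..., W_{L-1}), W_l an n_{l+1} x (n_l + 1) matrix, viewed  *)
(* as a vector indexed by the finite type pidx L n of triples (l, i, j).   *)
Definition pidx (L : nat) (n : nat -> nat) : finType :=
  {l : 'I_L & ('I_(n l.+1) * 'I_((n l).+1))%type}.

(* The weight matrix W_l extracted from the flat parameter vector
   (the zero matrix for l >= L, which is never used). *)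
Definition Wof (R : realType) (L : nat) (n : nat -> nat)
    (theta : pidx L n -> R) (l : nat) : 'M[R]_(n l.+1, (n l).+1) :=
  \matrix_(i < n l.+1, j < (n l).+1)
    (match (l < L)%N as b return (l < L)%N = b -> R with
     | true => fun H =>
         theta (@Tagged 'I_L (Ordinal H)
                  (fun l0 : 'I_L => ('I_(n l0.+1) * 'I_((n l0).+1))%type) (i, j))
     | false => fun _ => 0
     end (erefl _)).

Definition hbar (R : realType) (m : nat) (h : 'cV[R]_m) : 'cV[R]_m.+1 :=
  \col_(i < m.+1) (if unlift ord_max i is Some j then h j 0 else 1).

Fixpoint hid (R : realType) (L : nat) (n : nat -> nat) (sigma : R -> R)
    (x : 'cV[R]_(n 0)) (theta : pidx L n -> R) (l : nat) : 'cV[R]_(n l) :=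
  match l return 'cV[R]_(n l) with
  | 0 => x
  | l'.+1 =>
      let z := Wof theta l' *m hbar (hid sigma x theta l') in
      if (l'.+1 < L)%N then map_mx sigma z else z
  end.

Definition hL (R : realType) (L : nat) (n : nat -> nat) (sigma : R -> R)
    (x : 'cV[R]_(n 0)) (theta : pidx L n -> R) : 'cV[R]_(n L) :=
  hid sigma x theta L.

Definition dotc (R : realType) (m : nat) (u v : 'cV[R]_m) : R :=
  \sum_(i < m) u i 0 * v i 0.

(* Exponential family p(y|h) = exp(t(y)^T h - F(h)) w.r.t. base measure nu *)
Definition logpart (R : realType) (dY : measure_display) (Y : measurableType dY)
    (nu : {measure set Y -> \bar R}) (m : nat) (t : Y -> 'cV[R]_m)
    (h : 'cV[R]_m) : R :=
  ln (fine (\int[nu]_y (expR (dotc (t y) h))%:E)%E).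

Definition natparam (R : realType) (dY : measure_display) (Y : measurableType dY)
    (nu : {measure set Y -> \bar R}) (m : nat) (t : Y -> 'cV[R]_m) :
    set 'cV[R]_m :=
  [set h | (\int[nu]_y (expR (dotc (t y) h))%:E < +oo)%E].

Definition dens (R : realType) (dY : measure_display) (Y : measurableType dY)
    (nu : {measure set Y -> \bar R}) (m : nat) (t : Y -> 'cV[R]_m)
    (h : 'cV[R]_m) (y : Y) : R :=
  expR (dotc (t y) h - logpart nu t h).

Definition mexp (R : realType) (dY : measure_display) (Y : measurableType dY)
    (nu : {measure set Y -> \bar R}) (m : nat) (t : Y -> 'cV[R]_m)
    (h : 'cV[R]_m) (g : Y -> R) : R :=
  fine (\int[nu]_y (g y * dens nu t h y)%:E)%E.

Definition eta (R : realType) (dY : measure_display) (Y : measurableType dY)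
    (nu : {measure set Y -> \bar R}) (m : nat) (t : Y -> 'cV[R]_m)
    (h : 'cV[R]_m) (a : 'I_m) : R :=
  mexp nu t h (fun y => t y a 0).

Definition fisher (R : realType) (dY : measure_display) (Y : measurableType dY)
    (nu : {measure set Y -> \bar R}) (m : nat) (t : Y -> 'cV[R]_m)
    (h : 'cV[R]_m) (a b : 'I_m) : R :=
  mexp nu t h (fun y => (t y a 0 - eta nu t h a) * (t y b 0 - eta nu t h b)).

Definition kurt (R : realType) (dY : measure_display) (Y : measurableType dY)
    (nu : {measure set Y -> \bar R}) (m : nat) (t : Y -> 'cV[R]_m)
    (h : 'cV[R]_m) (a b c d : 'I_m) : R :=
  mexp nu t h (fun y => (t y a 0 - eta nu t h a) * (t y b 0 - eta nu t h b)
                        * (t y c 0 - eta nu t h c) * (t y d 0 - eta nu t h d)).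

Definition pderiv (R : realType) (P : finType) (f : (P -> R) -> R)
    (theta : P -> R) (p : P) : R :=
  derive1 (fun s : R => f (fun q => theta q + (if q == p then s else 0))) 0.

Definition C2 (R : realType) (sigma : R -> R) : Prop :=
  (forall z, derivable sigma z 1) /\
  (forall z, derivable (derive1 sigma) z 1) /\
  continuous (derive1 (derive1 sigma)).

Definition loglik (R : realType) (L : nat) (n : nat -> nat) (sigma : R -> R)
    (x : 'cV[R]_(n 0)) (dY : measure_display) (Y : measurableType dY)
    (nu : {measure set Y -> \bar R}) (t : Y -> 'cV[R]_(n L))
    (theta : pidx L n -> R) (y : Y) : R :=
  dotc (t y) (hL sigma x theta) - logpart nu t (hL sigma x theta).

Definition I1hat (R : realType) (L : nat) (n : nat -> nat) (sigma : R -> R)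
    (x : 'cV[R]_(n 0)) (dY : measure_display) (Y : measurableType dY)
    (nu : {measure set Y -> \bar R}) (t : Y -> 'cV[R]_(n L))
    (theta : pidx L n -> R) (Omega : Type) (N : nat) (Ys : 'I_N -> Omega -> Y)
    (p q : pidx L n) (w : Omega) : R :=
  N%:R^-1 * \sum_(i < N)
    (pderiv (fun th => loglik sigma x nu t th (Ys i w)) theta p *
     pderiv (fun th => loglik sigma x nu t th (Ys i w)) theta q).

Definition I2hat (R : realType) (L : nat) (n : nat -> nat) (sigma : R -> R)
    (x : 'cV[R]_(n 0)) (dY : measure_display) (Y : measurableType dY)
    (nu : {measure set Y -> \bar R}) (t : Y -> 'cV[R]_(n L))
    (theta : pidx L n -> R) (Omega : Type) (N : nat) (Ys : 'I_N -> Omega -> Y)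
    (p q : pidx L n) (w : Omega) : R :=
  N%:R^-1 * \sum_(i < N)
    (- pderiv (fun th =>
           pderiv (fun th' => loglik sigma x nu t th' (Ys i w)) th q) theta p).

Definition jacL (R : realType) (L : nat) (n : nat -> nat) (sigma : R -> R)
    (x : 'cV[R]_(n 0)) (theta : pidx L n -> R) (a : 'I_(n L)) (p : pidx L n) : R :=
  pderiv (fun th => hL sigma x th a 0) theta p.

Definition hessL (R : realType) (L : nat) (n : nat -> nat) (sigma : R -> R)
    (x : 'cV[R]_(n 0)) (theta : pidx L n -> R) (a : 'I_(n L)) (p q : pidx L n) : R :=
  pderiv (fun th => pderiv (fun th' => hL sigma x th' a 0) th q) theta p.

Definition ninf2 (R : realType) (A B : finType) (T : A -> B -> R) : R :=
  \big[Num.max/0]_(a : A) \big[Num.max/0]_(b : B) `|T a b|.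
Definition ninf3 (R : realType) (A B C : finType) (T : A -> B -> C -> R) : R :=
  \big[Num.max/0]_(a : A) \big[Num.max/0]_(b : B) \big[Num.max/0]_(c : C) `|T a b c|.
Definition ninf4 (R : realType) (A B C D : finType) (T : A -> B -> C -> D -> R) : R :=
  \big[Num.max/0]_(a : A) \big[Num.max/0]_(b : B) \big[Num.max/0]_(c : C)
    \big[Num.max/0]_(d : D) `|T a b c d|.
Definition none2 (R : realType) (A B : finType) (T : A -> B -> R) : R :=
  \sum_(a : A) \sum_(b : B) `|T a b|.
Definition none4 (R : realType) (A B C D : finType) (T : A -> B -> C -> D -> R) : R :=
  \sum_(a : A) \sum_(b : B) \sum_(c : C) \sum_(d : D) `|T a b c d|.

(* Main.v *)
(** Differentiating under the integral sign at an interior natural parameter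
    gives the score  d l / d theta_p = \sum_a (t_a - eta_a) J_(a,p)  and, up to a
    term that does not depend on y, the Hessian  \sum_a (t_a - eta_a) H_(a,p,q).
    An average of N i.i.d. terms has covariance 1/N times that of one term, so
    bilinearity writes the two covariance tensors as contractions of
    kurt - fisher (x) fisher with four Jacobians, and of fisher with two
    Hessians; the bounds are then Hoelder's inequality.

    Differentiation under the integral rests on the estimate
    |exp w - 1 - w| <= w ^ 2 exp |w|: the second-order remainder of the moments
    is bounded uniformly in a box around the parameter, so they can be
    differentiated along any curve that is merely differentiable at one point,
    which is all that is known of the network output. *)

From HB Require Import structures.
Require Import Defs.
From mathcomp Require Import all_boot all_order all_algebra.
From mathcomp Require Import all_classical all_reals all_analysis.
From mathcomp Require Import measurable_realfun ring lra.
Import Order.TTheory GRing.Theory Num.Theory.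
Import numFieldNormedType.Exports.

Set Implicit Arguments.
Unset Strict Implicit.
Unset Printing Implicit Defensive.

Local Open Scope classical_set_scope.
Local Open Scope ring_scope.

(** * Smoothness of the network in its parameters *)

Section partial_derivatives.
Context {R : realType} {P : finType}.
Implicit Types (f g : (P -> R) -> R) (theta : P -> R) (p q : P).

(** This is the perturbation inside [pderiv], so [pderiv f theta p] is by definition the derivative
    at 0 of [f] along this curve. *)
Definition shift_coord theta p (s : R) : P -> R :=
  fun q => theta q + (if q == p then s else 0).

(** Only partial derivatives are required, with no joint differentiability. The network is always
    differentiated along one coordinate line, where the one-variable sum, product and chain rules
    apply. *)
Definition pdiff f :=
  forall theta p, derivable (fun s : R => f (shift_coord theta p s)) 0 1.

Definition pdiff2 f := pdiff f /\ forall q, pdiff (fun th => pderiv f th q).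

Lemma shift_coord0 theta p : shift_coord theta p 0 = theta.
Proof. by apply/funext => q; rewrite /shift_coord; case: eqP; rewrite addr0. Qed.

Lemma pdiff_is_derive f theta p : pdiff f ->
  is_derive (0 : R) (1 : R) (fun s : R => f (shift_coord theta p s))
            (pderiv f theta p).
Proof.
by move=> df; apply: DeriveDef; [exact: df | rewrite /pderiv derive1E].
Qed.

Lemma pderivE f theta p (d : R) :
  is_derive (0 : R) (1 : R) (fun s : R => f (shift_coord theta p s)) d ->
  pderiv f theta p = d.
Proof. by move=> fd; rewrite /pderiv derive1E derive_val. Qed.

Lemma eq_pdiff f g : f =1 g -> pdiff g -> pdiff f.
Proof. by move=> /funext ->. Qed.

Lemma pdiff_cst (c : R) : pdiff (fun=> c).
Proof. by move=> theta p; exact: derivable_cst. Qed.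

Lemma pderiv_cst (c : R) theta p : pderiv (fun=> c) theta p = 0.
Proof. by apply: pderivE; exact: is_derive_cst. Qed.

Lemma is_derive_coord theta p q :
  is_derive (0 : R) (1 : R) (fun s : R => shift_coord theta p s q)
            (if q == p then 1 else 0).
Proof.
rewrite /shift_coord; case: eqP => _; last exact: is_derive_cst.
have := is_deriveD (is_derive_cst (theta q) (0 : R) 1) (is_derive_id (0 : R) 1).
by rewrite add0r.
Qed.

Lemma pdiff_coord q : pdiff (fun th => th q).
Proof. by move=> theta p; case: (is_derive_coord theta p q). Qed.

Lemma pdiffD f g : pdiff f -> pdiff g -> pdiff (fun th => f th + g th).
Proof. by move=> df dg theta p; exact: derivableD. Qed.

Lemma pderivD f g theta p : pdiff f -> pdiff g ->
  pderiv (fun th => f th + g th) theta p = pderiv f theta p + pderiv g theta p.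
Proof.
move=> df dg; apply: pderivE.
by apply: is_deriveD; exact: pdiff_is_derive.
Qed.

Lemma pdiffM f g : pdiff f -> pdiff g -> pdiff (fun th => f th * g th).
Proof. by move=> df dg theta p; exact: derivableM. Qed.

Lemma pderivM f g theta p : pdiff f -> pdiff g ->
  pderiv (fun th => f th * g th) theta p =
  f theta * pderiv g theta p + g theta * pderiv f theta p.
Proof.
move=> df dg; apply: pderivE.
have := is_deriveM (pdiff_is_derive theta p df) (pdiff_is_derive theta p dg).
by rewrite !shift_coord0.
Qed.

Lemma is_derive_pdiff_comp (u : R -> R) f theta p :
  derivable u (f theta) 1 -> pdiff f ->
  is_derive (0 : R) (1 : R) (fun s : R => u (f (shift_coord theta p s)))
            (derive1 u (f theta) * pderiv f theta p).
Proof.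
move=> du df.
have := @is_derive1_comp R u (fun s => f (shift_coord theta p s)) 0
  (derive1 u (f theta)) (pderiv f theta p).
rewrite shift_coord0; apply; last exact: pdiff_is_derive.
by rewrite derive1E; exact: derivableP.
Qed.

Lemma pdiff_comp (u : R -> R) f : (forall z, derivable u z 1) ->
  pdiff f -> pdiff (fun th => u (f th)).
Proof. by move=> du df theta p; case: (@is_derive_pdiff_comp u f theta p). Qed.

Lemma pderiv_comp (u : R -> R) f theta p : (forall z, derivable u z 1) ->
  pdiff f -> pderiv (fun th => u (f th)) theta p =
             derive1 u (f theta) * pderiv f theta p.
Proof. by move=> du df; apply: pderivE; exact: is_derive_pdiff_comp. Qed.

Lemma pdiff_sum n (F : 'I_n -> (P -> R) -> R) :
  (forall i, pdiff (F i)) -> pdiff (fun th => \sum_i F i th).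
Proof.
elim: n F => [|n ih] F dF.
  by under eq_fun do rewrite big_ord0; exact: pdiff_cst.
have -> : (fun th => \sum_i F i th) =
    (fun th => \sum_(i < n) F (widen_ord (leqnSn n) i) th + F ord_max th).
  by apply/funext => th; rewrite big_ord_recr.
by apply: pdiffD => //; exact: ih.
Qed.

Lemma pdiff2_cst (c : R) : pdiff2 (fun=> c).
Proof.
split=> [|q]; first exact: pdiff_cst.
by apply: (eq_pdiff (fun th => pderiv_cst c th q)); exact: pdiff_cst.
Qed.

Lemma pdiff2_coord q : pdiff2 (fun th => th q).
Proof.
split=> [|q']; first exact: pdiff_coord.
by apply: (eq_pdiff (fun th => pderivE (is_derive_coord th q' q))); exact: pdiff_cst.
Qed.

Lemma pdiff2D f g : pdiff2 f -> pdiff2 g -> pdiff2 (fun th => f th + g th).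
Proof.
move=> [df d2f] [dg d2g]; split=> [|q]; first exact: pdiffD.
apply: (eq_pdiff (fun th => pderivD th q df dg)); exact: pdiffD.
Qed.

Lemma pdiff2M f g : pdiff2 f -> pdiff2 g -> pdiff2 (fun th => f th * g th).
Proof.
move=> [df d2f] [dg d2g]; split=> [|q]; first exact: pdiffM.
by apply: (eq_pdiff (fun th => pderivM th q df dg)); apply: pdiffD; exact: pdiffM.
Qed.

Lemma pdiff2_comp (u : R -> R) f : (forall z, derivable u z 1) ->
  (forall z, derivable (derive1 u) z 1) -> pdiff2 f -> pdiff2 (fun th => u (f th)).
Proof.
move=> du d2u [df d2f]; split=> [|q]; first exact: pdiff_comp.
apply: (eq_pdiff (fun th => pderiv_comp th q du df)).
by apply: pdiffM => //; exact: pdiff_comp.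
Qed.

Lemma pdiff2_sum n (F : 'I_n -> (P -> R) -> R) :
  (forall i, pdiff2 (F i)) -> pdiff2 (fun th => \sum_i F i th).
Proof.
elim: n F => [|n ih] F dF.
  by under eq_fun do rewrite big_ord0; exact: pdiff2_cst.
have -> : (fun th => \sum_i F i th) =
    (fun th => \sum_(i < n) F (widen_ord (leqnSn n) i) th + F ord_max th).
  by apply/funext => th; rewrite big_ord_recr.
by apply: pdiff2D => //; exact: ih.
Qed.

End partial_derivatives.

Section network.
Context {R : realType} {L : nat} {n : nat -> nat}.
Variables (sigma : R -> R) (x : 'cV[R]_(n 0)).

(* Both smoothness classes contain the parameters and are closed under the
   operations that build the network, so one induction serves them both. *)
Lemma hid_closed (D : ((pidx L n -> R) -> R) -> Prop) :
  (forall c, D (fun=> c)) -> (forall q, D (fun th => th q)) ->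
  (forall f g, D f -> D g -> D (fun th => f th * g th)) ->
  (forall m (F : 'I_m -> (pidx L n -> R) -> R),
     (forall i, D (F i)) -> D (fun th => \sum_i F i th)) ->
  (forall f, D f -> D (fun th => sigma (f th))) ->
  forall l i, D (fun th => hid sigma x th l i 0).
Proof.
move=> Dc Dq DM Ds Du; elim=> [|l ih] i; first exact: Dc.
have Dz : D (fun th => (Wof th l *m hbar (hid sigma x th l)) i 0).
  under eq_fun do rewrite mxE.
  apply: Ds => j; apply: DM.
    under eq_fun do rewrite mxE.
    (* The match in [Wof] is applied to a proof about [l < L]. Generalizing that proof allows the
       case split: a weight is either a coordinate of the parameter or 0. *)
    move: (erefl (l < L)%N); case: {2 3}(l < L)%N => H; first exact: Dq.
    exact: Dc.
  under eq_fun do rewrite mxE.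
  by case: (unlift _ _) => [k|]; [exact: ih | exact: Dc].
rewrite /=; case: (l.+1 < L)%N => //.
by under eq_fun do rewrite mxE; exact: Du.
Qed.

Lemma pdiff_hL : (forall z, derivable sigma z 1) ->
  forall a, pdiff (fun th : pidx L n -> R => hL sigma x th a 0).
Proof.
move=> ds; apply: hid_closed => *.
- exact: pdiff_cst.
- exact: pdiff_coord.
- exact: pdiffM.
- exact: pdiff_sum.
- exact: pdiff_comp.
Qed.

Lemma pdiff2_hL : C2 sigma ->
  forall a, pdiff2 (fun th : pidx L n -> R => hL sigma x th a 0).
Proof.
move=> [ds [d2s _]]; apply: hid_closed => *.
- exact: pdiff2_cst.
- exact: pdiff2_coord.
- exact: pdiff2M.
- exact: pdiff2_sum.
- exact: pdiff2_comp.
Qed.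

End network.

(** * Taylor estimates and finite sums of integrals *)

Section real_analysis.
Context {R : realType}.

(** Everything follows from [exp v - 1 <= v * exp v]. At [w] it bounds the remainder by
    [w * (exp w - 1)], and what is left, [|exp w - 1| <= |w| * exp |w|], is treated by the sign of
    [w]. *)
Lemma normr_expR_taylor2 (w : R) :
  `|expR w - 1 - w| <= w ^+ 2 * expR `|w|.
Proof.
have e1 (v : R) : expR v - 1 <= v * expR v.
  have := expR_ge1Dx (- v); rewrite -(ler_pM2l (expR_gt0 v)) expRxMexpNx_1; lra.
have h1 := expR_ge1Dx w; rewrite ger0_norm; last lra.
have -> : w ^+ 2 = `|w| * `|w| by rewrite -normrM ger0_norm // -expr2 sqr_ge0.
apply: (@le_trans _ _ (w * (expR w - 1))); first by have := e1 w; lra.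
rewrite (le_trans (ler_norm _)) // normrM -mulrA ler_wpM2l //.
have [w0|w0] := leP 0 w.
  by rewrite !ger0_norm //; lra || exact: e1.
rewrite ltr0_norm ?subr_lt0 ?expR_lt1 // ltr0_norm //.
apply: (@le_trans _ _ (- w * 1)); first by lra.
by rewrite ler_wpM2l //; have := expR_ge1Dx (- w); lra.
Qed.

(** A single term of the exponential series at [r * (1 + s)] dominates the power, and the factor
    [exp r] goes into [K]. Raising the exponent to [k.+1] fits the form
    [1 + x ^ k.+1 / k.+1! <= exp x] of the series bound. *)
Lemma exprn_le_expR (r : R) k : 0 < r ->
  exists2 K, 0 <= K & forall s, 0 <= s -> (1 + s) ^+ k <= K * expR (r * s).
Proof.
move=> r0; exists (k.+1`!%:R / r ^+ k.+1 * expR r) => [|s s0].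
  by rewrite mulr_ge0 ?expR_ge0 // divr_ge0 // exprn_ge0 // ltW.
apply: (@le_trans _ _ ((1 + s) ^+ k.+1)).
  by rewrite ler_weXn2l // lerDl.
have rs : 0 <= r * (1 + s) by rewrite mulr_ge0 ?ltW // ltr_wpDr.
have -> : (1 + s) ^+ k.+1 =
    k.+1`!%:R / r ^+ k.+1 * ((r * (1 + s)) ^+ k.+1 / k.+1`!%:R).
  have k0 : k.+1`!%:R != 0 :> R by rewrite pnatr_eq0 -lt0n fact_gt0.
  have rk0 : r ^+ k.+1 != 0 by rewrite expf_neq0 // gt_eqF.
  rewrite exprMn; move: k0 rk0.
  move: (k.+1`!%:R) (r ^+ _) ((1 + s) ^+ _) => F u v F0 u0.
  by field; rewrite F0 u0.
rewrite -[leRHS]mulrA ler_wpM2l ?divr_ge0 ?exprn_ge0 ?(ltW r0) //.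
rewrite -expRD (_ : r + r * s = r * (1 + s)); last by ring.
by apply: le_trans (expR_ge1Dxn k rs); rewrite lerDr.
Qed.

(** The difference quotient of [e] at 0 is squeezed by [|C|] times that of [q], which tends to 0.
    This disposes of second-order remainders along a curve. *)
Lemma is_derive_dominated (e q : R -> R) (C : R) :
  is_derive (0 : R) (1 : R) q 0 -> q 0 = 0 ->
  (\forall s \near 0, `|e s| <= C * q s) ->
  is_derive (0 : R) (1 : R) e 0.
Proof.
move=> [dq dq0] q0 eq.
have e0 : e 0 = 0.
  by apply/eqP; rewrite -normr_le0 (le_trans (nbhs_singleton eq)) // q0 mulr0.
have dqcvg : (fun h : R => h^-1 *: ((q \o shift 0) (h *: (1 : R)) - q 0)) @ 0^'
    --> 'D_1 q 0 by exact: dq.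
have ecvg : (fun h : R => h^-1 *: ((e \o shift 0) (h *: (1 : R)) - e 0)) @ 0^' --> (0 : R).
  apply/norm_cvg0P.
  have qcvg : (fun h : R => `|C| * `|h^-1 *: ((q \o shift 0) (h *: (1 : R)) - q 0)|)
      @ 0^' --> (0 : R).
    rewrite -[X in _ --> X](mulr0 `|C|); apply: cvgM; first exact: cvg_cst.
    by apply/norm_cvg0P; rewrite dq0 in dqcvg.
  apply: (squeeze_cvgr _ (cvg_cst 0) qcvg).
  near=> h; rewrite normr_ge0 /= !addr0 e0 q0 !subr0 !normrM mulrCA ler_wpM2l //.
  rewrite -normrM (le_trans _ (ler_norm _)) // (_ : h%:A = h :> R); last exact: mulr1.
  by near: h; exact: (@cvg_within _ _ _ _ _ eq).
by apply: DeriveDef; [apply/cvg_ex; exists 0 | exact: cvg_lim].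
Unshelve. all: by end_near. Qed.

End real_analysis.

Section Rintegral_sum.
Context d (T : measurableType d) (R : realType).
Variables (mu : {measure set T -> \bar R}) (D : set T) (mD : measurable D).

Lemma integrable_sumr (I : Type) (f : I -> T -> R) (s : seq I) :
  (forall i, mu.-integrable D (EFin \o f i)) ->
  mu.-integrable D (EFin \o (fun x => \sum_(i <- s) f i x)).
Proof.
move=> fi; have := @integrable_sum _ T R mu D mD I s xpredT _ (fun i _ => fi i).
by apply: eq_integrable => // x _; rewrite /= sumEFin.
Qed.

Lemma Rintegral_sum (I : Type) (f : I -> T -> R) (s : seq I) :
  (forall i, mu.-integrable D (EFin \o f i)) ->
  (\int[mu]_(x in D) \sum_(i <- s) f i x = \sum_(i <- s) \int[mu]_(x in D) f i x)%R.
Proof.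
move=> fi; elim: s => [|i s ih].
  by under eq_Rintegral do rewrite big_nil; rewrite big_nil Rintegral_cst // mul0r.
under eq_Rintegral do rewrite big_cons.
by rewrite RintegralD // ?big_cons ?ih //; exact: integrable_sumr.
Qed.

End Rintegral_sum.

(** * Exponential families *)

Section exponential_family.
Context {R : realType} {dY : measure_display} {Y : measurableType dY}.
Variables (nu : {measure set Y -> \bar R}) (m : nat) (t : Y -> 'cV[R]_m).
Hypothesis mt : forall a, measurable_fun setT (fun y => t y a 0).
Implicit Types (f g : Y -> R) (h : 'cV[R]_m).

Definition l1 (y : Y) : R := \sum_a `|t y a 0|.

Lemma l1_ge0 y : 0 <= l1 y.
Proof. exact: sumr_ge0. Qed.

Lemma normr_le_l1 y a : `|t y a 0| <= l1 y.
Proof. by rewrite /l1 (bigD1 a) //= lerDl sumr_ge0. Qed.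

Lemma measurable_l1 : measurable_fun setT l1.
Proof. by apply: measurable_sum => a; exact: measurableT_comp. Qed.

Lemma measurable_dotc h : measurable_fun setT (fun y => dotc (t y) h).
Proof. by apply: measurable_sum => a; exact: measurable_funM. Qed.

(** This class serves as a certificate of integrability: it contains the constants and the
    coordinates of [t], is closed under sums and products, and its members are integrable against
    the density at interior parameters. *)
Definition poly_growth f := measurable_fun setT f /\
  exists C k, 0 <= C /\ forall y, `|f y| <= C * (1 + l1 y) ^+ k.

Lemma poly_growth_cst (c : R) : poly_growth (fun=> c).
Proof.
by split=> //; exists `|c|, 0%N; split=> // y; rewrite expr0 mulr1.
Qed.

Lemma poly_growth_coord a : poly_growth (fun y => t y a 0).
Proof.
split=> //; exists 1, 1%N; split=> // y; rewrite mul1r expr1.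
by rewrite (le_trans (normr_le_l1 y a)) // lerDr.
Qed.

Lemma poly_growth_l1 : poly_growth l1.
Proof.
split; first exact: measurable_l1.
by exists 1, 1%N; split=> // y; rewrite mul1r expr1 ger0_norm ?l1_ge0 // lerDr.
Qed.

Lemma poly_growth_norm f : poly_growth f -> poly_growth (fun y => `|f y|).
Proof.
move=> [mf [C [k [C0 fC]]]]; split; first exact: measurableT_comp.
by exists C, k; split=> // y; rewrite normr_id.
Qed.

Lemma poly_growthM f g :
  poly_growth f -> poly_growth g -> poly_growth (fun y => f y * g y).
Proof.
move=> [mf [C [k [C0 fC]]]] [mg [C' [k' [C'0 gC]]]].
split; first exact: measurable_funM.
exists (C * C'), (k + k')%N; split=> [|y]; first exact: mulr_ge0.
by rewrite normrM exprD mulrACA ler_pM.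
Qed.

Lemma poly_growthD f g :
  poly_growth f -> poly_growth g -> poly_growth (fun y => f y + g y).
Proof.
move=> [mf [C [k [C0 fC]]]] [mg [C' [k' [C'0 gC]]]].
split; first exact: measurable_funD.
exists (C + C'), (k + k')%N; split=> [|y]; first exact: addr_ge0.
have s1 : 1 <= 1 + l1 y by rewrite lerDl l1_ge0.
rewrite (le_trans (ler_normD _ _)) // mulrDl lerD //.
- by rewrite (le_trans (fC y)) // ler_wpM2l // ler_weXn2l // leq_addr.
- by rewrite (le_trans (gC y)) // ler_wpM2l // ler_weXn2l // leq_addl.
Qed.

Lemma poly_growth_sum (I : Type) (s : seq I) (F : I -> Y -> R) :
  (forall i, poly_growth (F i)) -> poly_growth (fun y => \sum_(i <- s) F i y).
Proof.
move=> pF; elim: s => [|i s ih].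
  by under eq_fun do rewrite big_nil; exact: poly_growth_cst.
by under eq_fun do rewrite big_cons; exact: poly_growthD.
Qed.

(** A closed cube of half-width [D] inside the natural parameter space. Its corners supply the sign
    vectors used to integrate [exp (D * l1)]. *)
Definition in_box h0 (D : R) :=
  0 < D /\ forall h, (forall a, `|h a 0 - h0 a 0| <= D) -> natparam nu t h.

Lemma interior_natparam_box h0 :
  interior (natparam nu t) h0 -> exists D, in_box h0 D.
Proof.
move=> /nbhs_ballP[e /= e0 be]; exists (e / 2); split=> [|h hD].
  by rewrite divr_gt0.
apply: be; split=> // a j; rewrite (ord1 j) /ball /= distrC.
by rewrite (le_lt_trans (hD a)) // ltr_pdivrMr // ltr_pMr // ltr1n.
Qed.

Lemma in_box_near h0 D h : in_box h0 D ->
  (forall a, `|h a 0 - h0 a 0| <= D / 2) -> in_box h (D / 2).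
Proof.
move=> [D0 hD] hh; split=> [|h' hh']; first by rewrite divr_gt0.
apply: hD => a; rewrite -(subrKA (h a 0)) (splitr D).
by rewrite (le_trans (ler_normD _ _)) // lerD.
Qed.

(* exp (D * l1) is at most the sum of exp (<eps, t>) over the 2 ^ m sign
   vectors eps with entries +D or -D. *)
Lemma integrable_exp_l1 h0 D : in_box h0 D ->
  nu.-integrable setT (EFin \o (fun y => expR (dotc (t y) h0 + D * l1 y))).
Proof.
move=> [D0 hD].
pose hs (e : {ffun 'I_m -> bool}) : 'cV[R]_m :=
  \col_a (h0 a 0 + (-1) ^+ e a * D).
have inh e : nu.-integrable setT (EFin \o (fun y => expR (dotc (t y) (hs e)))).
  apply/integrableP; split.
    apply/measurable_EFinP; apply: measurableT_comp => //.
    exact: measurable_dotc.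
  have := hD (hs e) _; rewrite /natparam /=.
  under eq_integral do rewrite -[(expR _)%:E]gee0_abs ?lee_fin ?expR_ge0 //.
  apply => a; rewrite mxE addrC addKr normrMsign gtr0_norm //.
have := @integrable_sumr _ Y R nu setT measurableT _ _ (index_enum _) inh.
apply: le_integrable => //.
  apply/measurable_EFinP; apply: measurableT_comp => //.
  apply: measurable_funD; first exact: measurable_dotc.
  by apply: measurable_funM => //; exact: measurable_l1.
move=> y _; rewrite /= lee_fin ger0_norm ?expR_ge0 // ger0_norm; last first.
  by apply: sumr_ge0 => e _; exact: expR_ge0.
(* The sum over the corners factors over the coordinates. Each factor [exp (D t_a) + exp (- D t_a)]
   is at least [exp (D |t_a|)]. *)
have -> : \sum_e expR (dotc (t y) (hs e)) =
    expR (dotc (t y) h0) * \prod_a \sum_(b : bool) expR ((-1) ^+ b * (D * t y a 0)).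
  rewrite bigA_distr_bigA /= mulr_sumr; apply: eq_bigr => e _.
  rewrite -expR_sum -expRD /dotc -big_split /=; congr expR.
  by apply: eq_bigr => a _; rewrite mxE; ring.
rewrite expRD ler_pM2l ?expR_gt0 // /l1 mulr_sumr expR_sum.
apply: ler_prod => a _; rewrite expR_ge0 /= big_bool /= expr0 expr1 mul1r mulN1r.
have [ta|ta] := leP 0 (t y a 0).
  by rewrite ger0_norm // lerDr expR_ge0.
by rewrite ltr0_norm // mulrN lerDl expR_ge0.
Qed.

(** Half of the exponential margin [D] absorbs the polynomial growth of [f]. The other half
    survives, to dominate Taylor remainders uniformly over the smaller box. *)
Lemma integrable_poly_growth_exp_l1 h0 D f : in_box h0 D -> poly_growth f ->
  nu.-integrable setT
    (EFin \o (fun y => f y * expR (dotc (t y) h0 + D / 2 * l1 y))).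
Proof.
move=> bD [mf [C [k [C0 fC]]]].
have [D0 _] := bD; have D20 : 0 < D / 2 by rewrite divr_gt0.
have [K K0 KP] := exprn_le_expR k D20.
have := integrableZl measurableT (C * K) (integrable_exp_l1 bD).
apply: le_integrable => //.
  apply/measurable_EFinP; apply: measurable_funM => //.
  apply: measurableT_comp => //.
  apply: measurable_funD; first exact: measurable_dotc.
  by apply: measurable_funM => //; exact: measurable_l1.
move=> y _; rewrite /= lee_fin !normrM (ger0_norm C0) (ger0_norm K0).
rewrite !(ger0_norm (expR_ge0 _)).
rewrite [X in _ <= X * _](_ : _ = C * K) //.
have -> : dotc (t y) h0 + D * l1 y = D / 2 * l1 y + (dotc (t y) h0 + D / 2 * l1 y).
  by rewrite {1}(splitr D); ring.
rewrite [in leRHS]expRD mulrA ler_wpM2r ?expR_ge0 // (le_trans (fC y)) // -mulrA.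
by rewrite ler_wpM2l // KP // l1_ge0.
Qed.

(** The unnormalized moment: at [f = 1] it is the partition function, and expectations under the
    model are quotients of two such moments. *)
Definition emoment f h : R := \int[nu]_y (f y * expR (dotc (t y) h)).

Lemma integrable_emoment h0 D f : in_box h0 D -> poly_growth f ->
  nu.-integrable setT (EFin \o (fun y => f y * expR (dotc (t y) h0))).
Proof.
move=> bD pf; have := integrable_poly_growth_exp_l1 bD pf.
have [D0 _] := bD.
apply: le_integrable => //.
  apply/measurable_EFinP; apply: measurable_funM; first by case: pf.
  by apply: measurableT_comp => //; exact: measurable_dotc.
move=> y _; rewrite /= lee_fin !normrM ler_wpM2l // !ger0_norm ?expR_ge0 //.
by rewrite ler_expR lerDl mulr_ge0 ?l1_ge0 // divr_ge0 // ltW.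
Qed.

(** With [w] the pairing of [t] with [h - h0], the integrand of the remainder is
    [f * exp <t, h0> * (exp w - 1 - w)]. The exponential estimate bounds it by the squared distance
    times a function that does not depend on [h]; the constant is the integral of that function. *)
Lemma emoment_taylor1 h0 D f : in_box h0 D -> poly_growth f ->
  exists C, forall h, (forall a, `|h a 0 - h0 a 0| <= D / 2) ->
    `|emoment f h - emoment f h0
      - \sum_a (h a 0 - h0 a 0) * emoment (fun y => f y * t y a 0) h0|
    <= C * \sum_a (h a 0 - h0 a 0) ^+ 2.
Proof.
move=> bD pf; have [D0 _] := bD.
have pg : poly_growth (fun y => `|f y| * (l1 y * l1 y)).
  apply: poly_growthM; first exact: poly_growth_norm.
  by apply: poly_growthM; exact: poly_growth_l1.
have ig := integrable_poly_growth_exp_l1 bD pg.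
exists (\int[nu]_y (`|f y| * (l1 y * l1 y) * expR (dotc (t y) h0 + D / 2 * l1 y))).
move=> h hD; pose q := \sum_a (h a 0 - h0 a 0) ^+ 2.
have q0 : 0 <= q by apply: sumr_ge0 => a _; exact: sqr_ge0.
have ih := integrable_emoment (in_box_near bD hD) pf.
have ih0 := integrable_emoment bD pf.
have ia a : nu.-integrable setT
    (EFin \o (fun y => (h a 0 - h0 a 0) * (f y * t y a 0 * expR (dotc (t y) h0)))).
  have := integrable_emoment bD (poly_growthM pf (poly_growth_coord a)).
  by move=> /(integrableZl measurableT (h a 0 - h0 a 0)); apply: eq_integrable.
have isum := @integrable_sumr _ Y R nu setT measurableT _ _ (index_enum _) ia.
have ib := integrableB measurableT ih ih0.
have -> : emoment f h - emoment f h0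
      - \sum_a (h a 0 - h0 a 0) * emoment (fun y => f y * t y a 0) h0 =
    \int[nu]_y (f y * expR (dotc (t y) h) - f y * expR (dotc (t y) h0)
      - \sum_a (h a 0 - h0 a 0) * (f y * t y a 0 * expR (dotc (t y) h0))).
  rewrite RintegralB // RintegralB // Rintegral_sum //; congr (_ - _).
  apply: eq_bigr => a _; rewrite RintegralZl //.
  exact: integrable_emoment bD (poly_growthM pf (poly_growth_coord a)).
rewrite -/q mulrC -RintegralZl //.
have id := integrableB measurableT ib isum.
rewrite (le_trans (le_normr_Rintegral measurableT id)) //.
apply: le_Rintegral => //.
- exact: integrable_norm id.
- by have := integrableZl measurableT q ig; apply: eq_integrable.
move=> y _.
pose w := \sum_a t y a 0 * (h a 0 - h0 a 0).
have dw : dotc (t y) h = dotc (t y) h0 + w.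
  by rewrite /dotc /w -big_split /=; apply: eq_bigr => a _; ring.
have -> : f y * expR (dotc (t y) h) - f y * expR (dotc (t y) h0) -
    \sum_a (h a 0 - h0 a 0) * (f y * t y a 0 * expR (dotc (t y) h0)) =
    f y * expR (dotc (t y) h0) * (expR w - 1 - w).
  have -> : \sum_a (h a 0 - h0 a 0) * (f y * t y a 0 * expR (dotc (t y) h0)) =
      f y * expR (dotc (t y) h0) * w.
    by rewrite /w mulr_sumr; apply: eq_bigr => a _; ring.
  by rewrite dw expRD; ring.
(* Used twice: with [c = sqrt q] it gives the quadratic factor, and with [c = D / 2] it controls
   [exp |w|]. *)
have wl (c : R) : (forall a, `|h a 0 - h0 a 0| <= c) -> `|w| <= c * l1 y.
  move=> hc; rewrite (le_trans (ler_norm_sum _ _ _)) // /l1 mulr_sumr.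
  by apply: ler_sum => a _; rewrite normrM mulrC ler_wpM2r.
have w2 : w ^+ 2 <= q * (l1 y * l1 y).
  have := wl (Num.sqrt q) _; rewrite -real_normK ?num_real // => /(_ _) hw.
  rewrite -{1}(sqr_sqrtr q0) -expr2 -exprMn ler_pXn2r ?nnegrE //.
  - apply: hw => a; rewrite -sqrtr_sqr ler_wsqrtr // /q (bigD1 a) //= lerDl.
    by apply: sumr_ge0 => b _; exact: sqr_ge0.
  - by rewrite mulr_ge0 ?sqrtr_ge0 ?l1_ge0.
rewrite !normrM (ger0_norm (expR_ge0 _)) expRD.
have -> : q * (`|f y| * (l1 y * l1 y) * (expR (dotc (t y) h0) * expR (D / 2 * l1 y)))
  = `|f y| * expR (dotc (t y) h0) * (q * (l1 y * l1 y) * expR (D / 2 * l1 y)) by ring.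
rewrite ler_wpM2l ?mulr_ge0 ?expR_ge0 // (le_trans (normr_expR_taylor2 w)) //.
by apply: ler_pM; rewrite ?sqr_ge0 ?expR_ge0 ?ler_expR ?wl.
Qed.

Lemma near_curve (c : R -> 'cV[R]_m) (e : R) :
  (forall a, derivable (fun s => c s a 0) 0 1) -> 0 < e ->
  \forall s \near 0, forall a, `|c s a 0 - c 0 a 0| <= e.
Proof.
move=> dc e0.
apply: (@filter_forall _ _ (fun a s => `|c s a 0 - c 0 a 0| <= e) (nbhs (0 : R)) _) => a.
have /derivable1_diffP/differentiable_continuous cc := dc a.
have /cvgrPdist_le/(_ e e0) : (fun s : R => c s a 0) @ (0 : R) --> c 0 a 0 by exact: cc.
by apply: filterS => s; rewrite distrC.
Qed.

(** The moment along the curve is a constant plus the linear part [lin] plus a remainder [e]. The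
    remainder is bounded by a multiple of [q], a sum of squares of functions vanishing at 0, so its
    derivative there is 0. *)
Lemma is_derive_emoment (c : R -> 'cV[R]_m) (c' : 'I_m -> R) D f :
  (forall a, is_derive (0 : R) (1 : R) (fun s => c s a 0) (c' a)) ->
  in_box (c 0) D -> poly_growth f ->
  is_derive (0 : R) (1 : R) (fun s => emoment f (c s))
    (\sum_a c' a * emoment (fun y => f y * t y a 0) (c 0)).
Proof.
move=> dc bD pf; have [D0 _] := bD.
have [C CP] := emoment_taylor1 bD pf.
pose lin s : R := \sum_a (c s a 0 - c 0 a 0) * emoment (fun y => f y * t y a 0) (c 0).
pose e s := emoment f (c s) - emoment f (c 0) - lin s.
pose q s : R := \sum_a (c s a 0 - c 0 a 0) ^+ 2.
have dB a : is_derive (0 : R) (1 : R) (fun s => c s a 0 - c 0 a 0) (c' a).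
  by have := is_deriveB (dc a) (is_derive_cst (c 0 a 0) (0 : R) 1); rewrite subr0.
have dq : is_derive (0 : R) (1 : R) q 0.
  have := @is_derive_sum _ _ _ m (fun a s => (c s a 0 - c 0 a 0) ^+ 2) 0 1 (fun=> 0).
  rewrite sumr_const mul0rn (_ : \sum_(a < m) _ = q); last first.
    by apply/funext => s; rewrite fct_sumE.
  apply => a; have := @is_deriveX _ _ (fun s => c s a 0 - c 0 a 0) 2 0 1 _ (dB a).
  by rewrite subrr expr1 mulr0 scale0r.
have dl : is_derive (0 : R) (1 : R) lin
    (\sum_a c' a * emoment (fun y => f y * t y a 0) (c 0)).
  have := @is_derive_sum _ _ _ m (fun a s => (c s a 0 - c 0 a 0) *
    emoment (fun y => f y * t y a 0) (c 0)) 0 1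
    (fun a => c' a * emoment (fun y => f y * t y a 0) (c 0)).
  rewrite (_ : \sum_(a < m) (fun s => _) = lin); last first.
    by apply/funext => s; rewrite fct_sumE.
  apply => a; have := is_deriveM (dB a)
    (is_derive_cst (emoment (fun y => f y * t y a 0) (c 0)) (0 : R) 1).
  by move=> /is_derive_eq; apply; rewrite scaler0 add0r; exact: mulrC.
have de : is_derive (0 : R) (1 : R) e 0.
  apply: (is_derive_dominated (C := C) dq); first by rewrite /q big1 // => a _; rewrite subrr expr0n.
  have nc := @near_curve c (D / 2) _ (divr_gt0 D0 (ltr0Sn _ 1)).
  move: nc => /(_ (fun a => @ex_derive _ _ _ _ _ _ _ (dc a))) nc.
  by near=> s; apply: CP; near: s.
have := is_deriveD (is_deriveD de dl) (is_derive_cst (emoment f (c 0)) (0 : R) 1).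
rewrite add0r addr0; congr (is_derive _ _ _ _); apply/funext => s.
by rewrite [LHS](_ : _ = e s + lin s + emoment f (c 0)) // /e; ring.
Unshelve. all: by end_near. Qed.

End exponential_family.

(** * Expectations under the model and the gradient of the log-partition function *)

Section model_expectation.
Context {R : realType} {dY : measure_display} {Y : measurableType dY}.
Variables (nu : {measure set Y -> \bar R}) (m : nat) (t : Y -> 'cV[R]_m).
Hypothesis mt : forall a, measurable_fun setT (fun y => t y a 0).
Hypothesis nu0 : nu setT <> 0%E.
Implicit Types (f g : Y -> R) (h : 'cV[R]_m).

Local Notation poly_growth := (poly_growth t).
Local Notation emoment := (emoment nu t).
Local Notation in_box := (in_box nu t).
Local Notation Z := (emoment (fun=> 1)).
Local Notation E := (mexp nu t).

Lemma logpartE h : logpart nu t h = ln (Z h).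
Proof.
by rewrite /logpart /emoment /Rintegral; under [in RHS]eq_integral do rewrite mul1r.
Qed.

(** A nonnegative function with zero integral vanishes almost everywhere. The exponential vanishes
    nowhere, so the whole space would be null, against [nu0]. *)
Lemma partition_gt0 h D : in_box h D -> 0 < Z h.
Proof.
move=> bD; have i1 := integrable_emoment mt bD (poly_growth_cst t 1).
rewrite lt_neqAle eq_sym Rintegral_ge0 ?andbT => [|y _]; last first.
  by rewrite mul1r expR_ge0.
apply/eqP => Z0; apply: nu0.
pose F y : R := 1 * expR (dotc (t y) h).
have mE : measurable_fun setT (EFin \o F).
  exact: (measurable_int nu).
have [+ _] := @ae_eq_integral_abs _ Y R nu setT measurableT _ mE.
have -> : (\int[nu]_y `|(EFin \o F) y| = 0)%E.
  rewrite (_ : (\int[nu]_y _ = \int[nu]_y (EFin \o F) y)%E); last first.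
    by apply: eq_integral => y _; rewrite gee0_abs // lee_fin /F mul1r expR_ge0.
  rewrite -(fineK (integrable_fin_num measurableT i1)).
  by rewrite (_ : fine _ = Z h) ?Z0.
move=> /(_ erefl) [N [mN N0 sN]].
apply/eqP; rewrite -measure_le0 -N0; apply: le_measure; rewrite ?inE //.
move=> y _; apply: sN => /= Fy0; case: (Fy0 I); rewrite /F mul1r => e0.
by have := expR_gt0 (dotc (t y) h); rewrite e0 ltxx.
Qed.

Lemma densE h D y : in_box h D -> dens nu t h y = expR (dotc (t y) h) / Z h.
Proof.
by move=> bD; rewrite /dens logpartE expRD expRN lnK // posrE (partition_gt0 bD).
Qed.

Lemma integrable_dens h D f : in_box h D -> poly_growth f ->
  nu.-integrable setT (EFin \o (fun y => f y * dens nu t h y)).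
Proof.
move=> bD pf; have := integrable_emoment mt bD pf.
move=> /(integrableZl measurableT (Z h)^-1); apply: eq_integrable => // y _ /=.
by rewrite (densE y bD) -EFinM; congr EFin; rewrite [LHS]mulrC mulrA.
Qed.

Lemma mexpE h D f : in_box h D -> poly_growth f -> E h f = emoment f h / Z h.
Proof.
move=> bD pf; rewrite /mexp -/(Rintegral _ _ _) mulrC -RintegralZl //.
  by apply: eq_Rintegral => y _; rewrite (densE y bD) mulrA mulrC.
exact: integrable_emoment bD pf.
Qed.

Lemma mexp_cst h D (c : R) : in_box h D -> E h (fun=> c) = c.
Proof.
move=> bD; rewrite (mexpE bD (poly_growth_cst t c)).
have -> : emoment (fun=> c) h = c * Z h.
  rewrite -RintegralZl //; first by apply: eq_Rintegral => y _; rewrite mul1r.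
  exact: (integrable_emoment mt bD (poly_growth_cst t 1)).
by rewrite mulfK // gt_eqF // (partition_gt0 bD).
Qed.

Lemma mexpZ h D (c : R) f : in_box h D -> poly_growth f ->
  E h (fun y => c * f y) = c * E h f.
Proof.
move=> bD pf; rewrite /mexp -/(Rintegral _ _ _) -/(Rintegral _ _ _).
rewrite -RintegralZl //; last exact: integrable_dens bD pf.
by apply: eq_Rintegral => y _; rewrite mulrA.
Qed.

Lemma mexpD h D f g : in_box h D -> poly_growth f -> poly_growth g ->
  E h (fun y => f y + g y) = E h f + E h g.
Proof.
move=> bD pf pg; rewrite /mexp -!/(Rintegral _ _ _).
rewrite -RintegralD //; [|exact: integrable_dens bD pf|exact: integrable_dens bD pg].
by apply: eq_Rintegral => y _; rewrite mulrDl.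
Qed.

Lemma mexp_sum (I : Type) (s : seq I) h D (F : I -> Y -> R) :
  in_box h D -> (forall i, poly_growth (F i)) ->
  E h (fun y => \sum_(i <- s) F i y) = \sum_(i <- s) E h (F i).
Proof.
move=> bD pF; elim: s => [|i s ih].
  by under eq_fun do rewrite big_nil; rewrite big_nil (mexp_cst 0 bD).
under eq_fun do rewrite big_cons.
by rewrite big_cons -ih (mexpD bD) //; exact: poly_growth_sum.
Qed.

Section along_a_curve.
Variables (c : R -> 'cV[R]_m) (c' : 'I_m -> R) (D : R).
Hypothesis dc : forall a, is_derive (0 : R) (1 : R) (fun s => c s a 0) (c' a).
Hypothesis bD : in_box (c 0) D.

(** The logarithmic derivative [Z' / Z]: differentiating [Z] brings out the unnormalized moments of
    the coordinates of [t], and division by [Z] turns them into [eta]. *)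
Lemma is_derive_logpart : is_derive (0 : R) (1 : R) (fun s => logpart nu t (c s))
  (\sum_a c' a * eta nu t (c 0) a).
Proof.
have dZ := is_derive_emoment mt dc bD (poly_growth_cst t 1).
have dln := is_derive1_ln (partition_gt0 bD).
have := @is_derive1_comp R (@ln R) (fun s => Z (c s)) 0 _ _ dln dZ.
rewrite (_ : @ln R \o _ = fun s => logpart nu t (c s)); last first.
  by apply/funext => s; rewrite /= logpartE.
move=> /is_derive_eq; apply; rewrite mulr_sumr; apply: eq_bigr => a _.
rewrite /eta (mexpE bD (poly_growth_coord mt a)) mulrCA; congr (_ * _).
by rewrite mulrC; congr (_ / _); apply: eq_Rintegral => y _; rewrite mul1r.
Qed.

Lemma derivable_eta a : derivable (fun s => eta nu t (c s) a) 0 1.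
Proof.
have pa := poly_growth_coord mt a.
have dG := is_derive_emoment mt dc bD pa.
have dZ := is_derive_emoment mt dc bD (poly_growth_cst t 1).
(* The quotient formula for [eta] is available only inside the box, where the curve stays for [s]
   near 0. *)
apply: (@near_eq_derivable _ _ _
    (fun s => emoment (fun y => t y a 0) (c s) * (Z (c s))^-1)) => //.
  have D20 : 0 < D / 2 by rewrite divr_gt0 //; case: bD.
  have nc := near_curve (fun a => @ex_derive _ _ _ _ _ _ _ (dc a)) D20.
  by near=> s; rewrite /eta (mexpE (in_box_near bD _) pa) //; near: s.
apply: derivableM; first exact: ex_derive.
apply: derivableV; last exact: ex_derive.
by rewrite gt_eqF // (partition_gt0 bD).
Unshelve. all: by end_near. Qed.

End along_a_curve.

End model_expectation.

(** * Score and Hessian of the log-likelihood *)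

Section score.
Context {R : realType} {L : nat} {n : nat -> nat}.
Context {dY : measure_display} {Y : measurableType dY}.
Variables (sigma : R -> R) (x : 'cV[R]_(n 0)).
Variables (nu : {measure set Y -> \bar R}) (t : Y -> 'cV[R]_(n L)).
Hypothesis dsigma : forall z, derivable sigma z 1.
Hypothesis mt : forall a, measurable_fun setT (fun y => t y a 0).
Hypothesis nu0 : nu setT <> 0%E.
Implicit Types (theta : pidx L n -> R) (p q : pidx L n) (y : Y).

Local Notation h := (hL sigma x).
Local Notation in_box := (in_box nu t).

Let is_derive_h theta p a :
  is_derive (0 : R) (1 : R) (fun s => h (shift_coord theta p s) a 0)
            (jacL sigma x theta a p).
Proof. exact: (pdiff_is_derive theta p (@pdiff_hL _ _ _ _ x dsigma a)). Qed.

Lemma pderiv_loglik theta D p y : in_box (h theta) D ->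
  pderiv (fun th => loglik sigma x nu t th y) theta p =
  \sum_a jacL sigma x theta a p * (t y a 0 - eta nu t (h theta) a).
Proof.
move=> bD; apply: pderivE; rewrite /loglik.
have bD0 : in_box (h (shift_coord theta p 0)) D by rewrite shift_coord0.
have dF := is_derive_logpart mt nu0 (is_derive_h theta p) bD0.
have dd : is_derive (0 : R) (1 : R)
    (fun s => dotc (t y) (h (shift_coord theta p s)))
    (\sum_a t y a 0 * jacL sigma x theta a p).
  have := @is_derive_sum _ _ _ _ (fun a s => t y a 0 * h (shift_coord theta p s) a 0)
    0 1 (fun a => t y a 0 * jacL sigma x theta a p).
  rewrite (_ : \sum_(a < n L) (fun s => _) =
    (fun s => dotc (t y) (h (shift_coord theta p s)))); last first.
    by apply/funext => s; rewrite fct_sumE.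
  by apply => a; exact: is_deriveZ.
have := is_deriveB dd dF; rewrite shift_coord0 -sumrB.
by move=> /is_derive_eq; apply; apply: eq_bigr => a _; ring.
Qed.

(** The product rule on the score gives a Hessian term and a term with the derivative of [eta]. The
    latter does not involve [y], so [k] can be chosen before [y]; as an additive constant it will
    not affect covariances. *)
Lemma pderiv2_loglik theta D p q : C2 sigma -> in_box (h theta) D ->
  exists k, forall y,
    pderiv (fun th => pderiv (fun th' => loglik sigma x nu t th' y) th q) theta p =
    \sum_a hessL sigma x theta a p q * (t y a 0 - eta nu t (h theta) a) - k.
Proof.
move=> C2s bD.
have bD0 : in_box (h (shift_coord theta p 0)) D by rewrite shift_coord0.
have D20 : 0 < D / 2 by rewrite divr_gt0 //; case: bD.
pose et a (s : R) := eta nu t (h (shift_coord theta p s)) a.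
have det a : is_derive (0 : R) (1 : R) (et a) ('D_1 (et a) 0).
  by apply: derivableP; exact: (derivable_eta mt nu0 (is_derive_h theta p) bD0).
exists (\sum_a jacL sigma x theta a q * 'D_1 (et a) 0) => y; apply: pderivE.
pose G a (s : R) := jacL sigma x (shift_coord theta p s) a q * (t y a 0 - et a s).
(* The score formula needs a box around the shifted parameter too. For small [s] the half-size box
   provides it, and a derivative at 0 depends only on such [s]. *)
apply: (@near_eq_is_derive _ _ _ (fun s => \sum_a G a s)) => //.
  have nc := near_curve (fun a => @ex_derive _ _ _ _ _ _ _ (is_derive_h theta p a)) D20.
  by near=> s; rewrite (pderiv_loglik _ _ (in_box_near bD0 _)) //; near: s.
have dJ a : is_derive (0 : R) (1 : R)
    (fun s => jacL sigma x (shift_coord theta p s) a q) (hessL sigma x theta a p q).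
  by have [_ /(_ q) d2] := @pdiff2_hL _ _ _ _ x C2s a; exact: (pdiff_is_derive theta p d2).
have := @is_derive_sum _ _ _ _ G 0 1 (fun a =>
   hessL sigma x theta a p q * (t y a 0 - eta nu t (h theta) a)
   - jacL sigma x theta a q * 'D_1 (et a) 0).
rewrite (_ : \sum_(a < n L) G a = fun s => \sum_a G a s); last first.
  by apply/funext => s; rewrite fct_sumE.
rewrite sumrB; apply => a.
have := is_deriveM (dJ a) (is_deriveB (is_derive_cst (t y a 0) (0 : R) 1) (det a)).
move=> /is_derive_eq; apply; rewrite !shift_coord0 sub0r /= -/(et a).
rewrite [LHS](_ : _ = jacL sigma x theta a q * - 'D_1 (et a) 0
   + (t y a 0 - et a 0) * hessL sigma x theta a p q) //.
by rewrite /et shift_coord0; ring.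
Unshelve. all: by end_near. Qed.

End score.

(** * Covariance of sample means *)

Section integral_density.
Local Open Scope ereal_scope.
Context d (T : measurableType d) (R : realType).
Variables (mu mu' : {measure set T -> \bar R}) (g : T -> R).
Hypothesis mg : measurable_fun setT g.
Hypothesis g0 : forall x, (0 <= g x)%R.
Hypothesis mu'E : forall A, measurable A -> mu' A = \int[mu]_(x in A) (g x)%:E.

Import HBNNSimple.

Let mgE (f : T -> R) : measurable_fun setT f ->
  measurable_fun setT (fun x => (f x)%:E * (g x)%:E).
Proof. by move=> mf; apply: emeasurable_funM; exact/measurable_EFinP. Qed.

Let nnsfun_density (f : {nnsfun T >-> R}) :
  \int[mu']_x (f x)%:E = \int[mu]_x ((f x)%:E * (g x)%:E).
Proof.
rewrite integralT_nnsfun sintegralE.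
under [RHS]eq_integral => x _.
  rewrite fimfunE -fsumEFin // ge0_mule_fsuml; last first.
    by move=> r; exact: nnfun_muleindic_ge0.
  over.
rewrite ge0_integral_fsum //; last 2 first.
- by move=> r; apply: mgE; exact: measurable_funM.
- by move=> r x _; rewrite mule_ge0 ?lee_fin // -lee_fin nnfun_muleindic_ge0.
apply: eq_fsbigr => r /[!inE] -[x _ <-].
rewrite mu'E // integral_mkcond -ge0_integralZl_EFin //=.
- apply: eq_integral => y _; rewrite patchE indicE.
  by case: ifPn => _; rewrite ?mulr1 // mulr0 mule0 mul0e.
- by move=> y _; rewrite patchE; case: ifPn => _; rewrite ?lee_fin.
- by apply/(measurable_restrictT _ _).1 => //; exact/measurable_funTS/measurable_EFinP.
Qed.

(** Monotone convergence along increasing simple functions extends [nnsfun_density], which itself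
    comes from [mu'E] on the level sets. *)
Lemma ge0_integral_density (f : T -> R) :
  measurable_fun setT f -> (forall x, 0 <= f x)%R ->
  \int[mu']_x (f x)%:E = \int[mu]_x (f x * g x)%:E.
Proof.
move=> mf f0.
have mEf : measurable_fun setT (EFin \o f) by exact/measurable_EFinP.
pose f_ := nnsfun_approx measurableT mEf.
have cf x : (f_ n x)%:E @[n --> \oo] --> (f x)%:E.
  by apply: (cvg_nnsfun_approx measurableT mEf) => // y _; rewrite lee_fin.
have ndf x : {homo (fun n => f_ n x) : m n / (m <= n)%N >-> (m <= n)%R}.
  by move=> m n mn; exact/lefP/nd_nnsfun_approx.
transitivity (limn (fun n => \int[mu']_x (f_ n x)%:E)).
  rewrite -monotone_convergence //.
  - by apply: eq_integral => x _; apply/esym/cvg_lim => //; exact: cf.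
  - by move=> n; exact/measurable_EFinP.
  - by move=> n x _; rewrite lee_fin.
  - by move=> x _ m n mn; rewrite lee_fin; exact: ndf.
under eq_fun do rewrite nnsfun_density.
rewrite -monotone_convergence //.
- apply: eq_integral => x _; apply/cvg_lim => //.
  by rewrite EFinM; apply: cvgeZr => //; exact: cf.
- by move=> n; exact: mgE.
- by move=> n x _; rewrite mule_ge0 ?lee_fin.
- by move=> x _ m n mn; rewrite lee_wpmul2r ?lee_fin //; exact: ndf.
Qed.

Lemma integrable_density (f : T -> R) : measurable_fun setT f ->
  mu.-integrable setT (EFin \o (fun x => f x * g x)%R) ->
  mu'.-integrable setT (EFin \o f).
Proof.
move=> mf /integrableP[_ fi]; apply/integrableP; split; first exact/measurable_EFinP.
rewrite /= ge0_integral_density //; last exact: measurableT_comp.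
by under eq_integral do rewrite -{1}(ger0_norm (g0 _)) -normrM.
Qed.

Lemma integral_density (f : T -> R) : measurable_fun setT f ->
  mu.-integrable setT (EFin \o (fun x => f x * g x)%R) ->
  \int[mu']_x (f x)%:E = \int[mu]_x (f x * g x)%:E.
Proof.
move=> mf fi.
(* Splitting into positive and negative parts reduces the signed case to the nonnegative one; both
   parts inherit integrability from [f]. *)
pose fp x : R := Num.max (f x) 0%R; pose fn x : R := Num.max (- f x)%R 0%R.
have fE x : f x = (fp x - fn x)%R.
  by rewrite /fp /fn; case: (leP (f x) 0%R); case: (leP (- f x)%R 0%R); lra.
have mfp : measurable_fun setT fp by exact: measurable_maxr.
have mfn : measurable_fun setT fn by apply: measurable_maxr => //; exact: measurableT_comp.
have fp0 x : (0 <= fp x)%R by rewrite /fp le_max lexx orbT.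
have fn0 x : (0 <= fn x)%R by rewrite /fn le_max lexx orbT.
have ifp : mu.-integrable setT (EFin \o (fun x => fp x * g x)%R).
  apply: le_integrable fi => //; first exact/measurable_EFinP/measurable_funM.
  move=> x _; rewrite /= lee_fin !normrM ler_wpM2r //.
  by rewrite /fp; case: (leP (f x) 0%R) => // _; rewrite normr0.
have ifn : mu.-integrable setT (EFin \o (fun x => fn x * g x)%R).
  apply: le_integrable fi => //; first exact/measurable_EFinP/measurable_funM.
  move=> x _; rewrite /= lee_fin !normrM ler_wpM2r //.
  by rewrite /fn; case: (leP (- f x)%R 0%R) => // _; rewrite ?normr0 ?normrN.
transitivity (\int[mu']_x (fp x)%:E - \int[mu']_x (fn x)%:E).
  rewrite -integralB_EFin //; try exact: integrable_density.
  by apply: eq_integral => x _; rewrite fE.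
rewrite !ge0_integral_density // -integralB_EFin //.
by apply: eq_integral => x _; rewrite -EFinB fE mulrBl.
Qed.

End integral_density.

(** * Means, products of independent variables, and covariances of averages *)

Section has_mean.
Context d {T : measurableType d} {R : realType} (P : probability T R).
Implicit Types (X Y : T -> R) (u v : R).

(** Bundling integrability with a real value keeps extended reals out of later computations:
    scaling, finite sums and independent products become arithmetic on [u]. *)
Definition has_mean X u :=
  P.-integrable setT (EFin \o X) /\ (\int[P]_w (X w)%:E = u%:E)%E.

Lemma eq_has_mean X Y u : X =1 Y -> has_mean X u -> has_mean Y u.
Proof. by move=> /funext ->. Qed.

Lemma has_meanZ (c : R) X u : has_mean X u -> has_mean (fun w => c * X w) (c * u).
Proof.
move=> [iX eX]; split.
  by have := integrableZl measurableT c iX; apply: eq_integrable.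
by under eq_integral do rewrite EFinM; rewrite integralZl // eX.
Qed.

Lemma has_mean_sum (I : Type) (s : seq I) (X : I -> T -> R) (u : I -> R) :
  (forall i, has_mean (X i) (u i)) ->
  has_mean (fun w => \sum_(i <- s) X i w) (\sum_(i <- s) u i).
Proof.
move=> hX; split; first by apply: integrable_sumr => // i; case: (hX i).
under eq_integral do rewrite -sumEFin.
rewrite integral_sum //; last by move=> i; case: (hX i).
by rewrite -sumEFin; apply: eq_bigr => i _; case: (hX i).
Qed.

Lemma covariance_has_mean X Y u v uv :
  has_mean X u -> has_mean Y v -> has_mean (fun w => X w * Y w) uv ->
  covariance P X Y = (uv - u * v)%:E.
Proof.
move=> [iX eX] [iY eY] [iXY eXY].
rewrite covarianceE; try exact/Lfun1_integrable.
by rewrite unlock eX eY [X in (X - _)%E](_ : _ = uv%:E).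
Qed.

(** Independence makes the joint law agree with the product of the marginals on rectangles, hence
    everywhere. Tonelli then gives integrability of the product and Fubini its value. *)
Lemma has_mean_indep X Y u v :
  (forall A B : set R, measurable A -> measurable B ->
    P (X @^-1` A `&` Y @^-1` B) = (P (X @^-1` A) * P (Y @^-1` B))%E) ->
  has_mean X u -> has_mean Y v -> has_mean (fun w => X w * Y w) (u * v).
Proof.
move=> XY [iX eX] [iY eY].
have mX : measurable_fun setT X by apply/measurable_EFinP; exact: (measurable_int P).
have mY : measurable_fun setT Y by apply/measurable_EFinP; exact: (measurable_int P).
have mXY : measurable_fun setT (fun w => (X w, Y w)) by exact: measurable_fun_pair.
pose rX : {mfun T >-> R} := HB.pack X (isMeasurableFun.Build _ _ _ _ _ mX).
pose rY : {mfun T >-> R} := HB.pack Y (isMeasurableFun.Build _ _ _ _ _ mY).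
pose rXY : {mfun T >-> (R * R)%type} :=
  HB.pack (fun w => (X w, Y w)) (isMeasurableFun.Build _ _ _ _ _ mXY).
pose m1 : probability _ R := distribution P rX.
pose m2 : probability _ R := distribution P rY.
pose mul (z : R * R) : R := z.1 * z.2.
have mmul : measurable_fun setT mul.
  by apply: measurable_funM; [exact: measurable_fst | exact: measurable_snd].
have jointE C : measurable C -> (m1 \x m2)%E C = distribution P rXY C.
  move=> mC; apply: product_measure_unique mC => A B mA mB.
  exact: XY.
have iid1 : m1.-integrable setT (EFin \o (idfun : R -> R)).
  by apply: (integrable_pushforward mX) => //; apply/measurable_EFinP; exact: measurable_id.
have iid2 : m2.-integrable setT (EFin \o (idfun : R -> R)).
  by apply: (integrable_pushforward mY) => //; apply/measurable_EFinP; exact: measurable_id.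
have e1 : (\int[m1]_z z%:E = u%:E)%E by rewrite -eX integral_distribution.
have e2 : (\int[m2]_z z%:E = v%:E)%E by rewrite -eY integral_distribution.
have iprod : (m1 \x m2)%E.-integrable setT (EFin \o mul).
  apply/integrable12ltyP; first exact/measurable_EFinP.
  have [_ i1] := integrableP _ _ _ iid1; have [_ i2] := integrableP _ _ _ iid2.
  have mabs : measurable_fun setT (fun z : R => `|z%:E|%E).
    by apply: measurableT_comp => //; apply/measurable_EFinP; exact: measurable_id.
  have absE z1 : (\int[m2]_z2 `|(EFin \o mul) (z1, z2)| =
      `|z1%:E| * \int[m2]_z2 `|z2%:E|)%E.
    rewrite -ge0_integralZl //.
    by apply: eq_integral => z2 _; rewrite /= normrM EFinM.
  under eq_integral do rewrite absE.
  rewrite ge0_integralZr //; last exact: integral_ge0.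
  by rewrite lte_mul_pinfty //; [exact: integral_ge0 | rewrite ge0_fin_numE // integral_ge0].
have ijoint : (distribution P rXY).-integrable setT (EFin \o mul).
  have /integrableP[mm im] := iprod; apply/integrableP; split => //.
  by rewrite -(eq_measure_integral _ (fun C mC _ => jointE C mC)).
have iP : P.-integrable setT (EFin \o (fun w => X w * Y w)).
  have /integrableP[mm im] := ijoint; apply/integrableP; split.
    exact/measurable_EFinP/measurable_funM.
  move: im; rewrite ge0_integral_distribution //.
  by apply: measurableT_comp.
split => //.
transitivity (\int[distribution P rXY]_z (EFin \o mul) z)%E.
  by rewrite integral_distribution //; exact/measurable_EFinP.
rewrite -(eq_measure_integral _ (fun C mC _ => jointE C mC)).
rewrite -integral12_prod_meas1 //.
have mulE z1 : (\int[m2]_z2 (EFin \o mul) (z1, z2) = z1%:E * v%:E)%E.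
  by under eq_integral do rewrite /= EFinM; rewrite integralZl // e2.
under eq_integral do rewrite /fubini_F mulE.
by rewrite integralZr // e1.
Qed.

(** Among the [N ^ 2] pairs of indices only the [N] diagonal ones contribute, each by [fg - f * g];
    the prefactor [N ^ -2] leaves [1 / N]. *)
Lemma covariance_mean N (F G : 'I_N -> T -> R) (f g fg : R) : (0 < N)%N ->
  (forall i, has_mean (F i) f) -> (forall i, has_mean (G i) g) ->
  (forall i, has_mean (fun w => F i w * G i w) fg) ->
  (forall i j, i != j -> has_mean (fun w => F i w * G j w) (f * g)) ->
  covariance P (fun w => N%:R^-1 * \sum_i F i w) (fun w => N%:R^-1 * \sum_i G i w)
  = (N%:R^-1 * (fg - f * g))%:E.
Proof.
move=> N0 hF hG hFG hFG'.
have N0' : N%:R != 0 :> R by rewrite pnatr_eq0 -lt0n.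
have hd i j : has_mean (fun w => F i w * G j w) (f * g + (if j == i then fg - f * g else 0)).
  by case: eqVneq => [->|ij]; rewrite ?addr0 ?subrKC //; apply: hFG'; rewrite eq_sym.
have h2 : has_mean (fun w => (N%:R^-1 * \sum_i F i w) * (N%:R^-1 * \sum_i G i w))
    (N%:R^-1 * N%:R^-1 * \sum_(i < N) \sum_(j < N)
      (f * g + (if j == i then fg - f * g else 0))).
  apply: eq_has_mean (has_meanZ _ (has_mean_sum _ (fun i => has_mean_sum _ (hd i)))).
  move=> w /=; rewrite mulrACA; congr (_ * _); rewrite mulr_suml.
  by apply: eq_bigr => i _; rewrite mulr_sumr.
rewrite (covariance_has_mean (has_meanZ _ (has_mean_sum _ hF))
  (has_meanZ _ (has_mean_sum _ hG)) h2); congr EFin.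
under eq_bigr => i _.
  rewrite big_split /= sumr_const card_ord -big_mkcond /= big_pred1_eq; over.
rewrite !sumr_const card_ord -(mulr_natl f) -(mulr_natl g) -(mulr_natl (f * g)).
rewrite -(mulr_natl (_ + _)).
by field.
Qed.

End has_mean.

(** * The bounds *)

Section tensor_norms.
Context {R : realType}.

Lemma le_ninf2 (A B : finType) (T : A -> B -> R) a b : `|T a b| <= ninf2 T.
Proof.
by apply: le_trans (le_bigmax _ _ a); exact: (le_bigmax _ (fun b => `|T a b|)).
Qed.

Lemma le_ninf3 (A B C : finType) (T : A -> B -> C -> R) a b c :
  `|T a b c| <= ninf3 T.
Proof. by apply: le_trans (le_bigmax _ _ a); exact: (@le_ninf2 B C (T a)). Qed.

Lemma ninf2_ge0 (A B : finType) (T : A -> B -> R) : 0 <= ninf2 T.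
Proof. exact: bigmax_ge_id. Qed.

Lemma ninf3_ge0 (A B C : finType) (T : A -> B -> C -> R) : 0 <= ninf3 T.
Proof. exact: bigmax_ge_id. Qed.

(** The condition [0 <= M] accounts for the default value 0 from which the maxima start. *)
Lemma ninf4_le (A B C D : finType) (T : A -> B -> C -> D -> R) (M : R) :
  0 <= M -> (forall a b c d, `|T a b c d| <= M) -> ninf4 T <= M.
Proof. by move=> M0 TM; do 4! (apply: bigmax_le => // ? _). Qed.

(** Hoelder's inequality between the maximum norm of the coefficients and the sum norm of the
    tensor. *)
Lemma normr_sum2_le (I J : finType) (c T : I -> J -> R) (M : R) :
  (forall i j, `|c i j| <= M) ->
  `|\sum_i \sum_j c i j * T i j| <= M * \sum_i \sum_j `|T i j|.
Proof.
move=> cM; rewrite (le_trans (ler_norm_sum _ _ _)) // mulr_sumr.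
apply: ler_sum => i _; rewrite (le_trans (ler_norm_sum _ _ _)) // mulr_sumr.
by apply: ler_sum => j _; rewrite normrM ler_wpM2r.
Qed.

(** Grouping the indices in pairs lets a fourth-order contraction be treated as a double sum. *)
Lemma none4E (A B C D : finType) (T : A -> B -> C -> D -> R) :
  none4 T = \sum_(i : A * B) \sum_(j : C * D) `|T i.1 i.2 j.1 j.2|.
Proof.
rewrite /none4 pair_bigA /=; apply: eq_bigr => i _.
by rewrite pair_bigA.
Qed.

End tensor_norms.

(** * Covariance of statistics under the model density, as a bilinear form *)

Section model_covariance.
Context {R : realType} {dY : measure_display} {Y : measurableType dY}.
Variables (nu : {measure set Y -> \bar R}) (m : nat) (t : Y -> 'cV[R]_m).
Hypothesis mt : forall a, measurable_fun setT (fun y => t y a 0).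
Hypothesis nu0 : nu setT <> 0%E.
Variables (h : 'cV[R]_m) (D : R).
Hypothesis bD : in_box nu t h D.
Implicit Types f g : Y -> R.

Local Notation poly_growth := (poly_growth t).
Local Notation E := (mexp nu t h).

Definition mcov f g : R := E (fun y => f y * g y) - E f * E g.

Lemma poly_growthZ (c : R) f : poly_growth f -> poly_growth (fun y => c * f y).
Proof. by move=> pf; apply: poly_growthM => //; exact: poly_growth_cst. Qed.

Lemma poly_growth_lincomb (I : finType) (c : I -> R) (F : I -> Y -> R) :
  (forall i, poly_growth (F i)) -> poly_growth (fun y => \sum_i c i * F i y).
Proof. by move=> pF; apply: poly_growth_sum => i; exact: poly_growthZ. Qed.

Lemma mexp_lincomb (I : finType) (c : I -> R) (F : I -> Y -> R) :
  (forall i, poly_growth (F i)) ->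
  E (fun y => \sum_i c i * F i y) = \sum_i c i * E (F i).
Proof.
move=> pF; rewrite (mexp_sum mt nu0 _ bD); last by move=> i; exact: poly_growthZ.
by apply: eq_bigr => i _; rewrite (mexpZ mt nu0 _ bD).
Qed.

Lemma mcov_lincomb (I J : finType) (c : I -> R) (c' : J -> R)
    (F : I -> Y -> R) (G : J -> Y -> R) :
  (forall i, poly_growth (F i)) -> (forall j, poly_growth (G j)) ->
  mcov (fun y => \sum_i c i * F i y) (fun y => \sum_j c' j * G j y) =
  \sum_i \sum_j c i * c' j * mcov (F i) (G j).
Proof.
move=> pF pG; rewrite /mcov !mexp_lincomb //.
have -> : E (fun y => (\sum_i c i * F i y) * (\sum_j c' j * G j y)) =
    \sum_i c i * \sum_j c' j * E (fun y => F i y * G j y).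
  under eq_fun => y.
    rewrite mulr_suml; under eq_bigr => i _.
      rewrite -mulrA mulr_sumr; under eq_bigr => j _ do rewrite mulrCA.
      over.
    over.
  rewrite mexp_lincomb => [|i]; last first.
    by apply: poly_growth_lincomb => j; exact: poly_growthM.
  apply: eq_bigr => i _; rewrite mexp_lincomb // => j; exact: poly_growthM.
rewrite mulr_suml -sumrB; apply: eq_bigr => i _.
rewrite !mulr_sumr -sumrB.
by apply: eq_bigr => j _; ring.
Qed.

(** Constants drop out and the two minus signs cancel. This removes the [y]-free part of the Hessian
    and the sign in [I2hat]. *)
Lemma mcov_shift f g (k l : R) : poly_growth f -> poly_growth g ->
  mcov (fun y => k - f y) (fun y => l - g y) = mcov f g.
Proof.
move=> pf pg.
have pc c : poly_growth (fun=> c) by exact: poly_growth_cst.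
have Eaff (c b : R) u : poly_growth u -> E (fun y => c + b * u y) = c + b * E u.
  move=> pu; rewrite (mexpD mt nu0 bD) //; last exact: poly_growthZ.
  by rewrite (mexp_cst mt nu0 _ bD) (mexpZ mt nu0 _ bD).
rewrite /mcov.
have -> : (fun y => k - f y) = (fun y => k + -1 * f y).
  by apply/funext => y; rewrite mulN1r.
have -> : (fun y => l - g y) = (fun y => l + -1 * g y).
  by apply/funext => y; rewrite mulN1r.
have -> : (fun y => (k - f y) * (l - g y)) =
    (fun y => (k * l + - l * f y) + (- k * g y + f y * g y)).
  by apply/funext => y; ring.
rewrite (mexpD mt nu0 bD (f := fun y => k * l + - l * f y)); last 2 first.
- by apply: poly_growthD => //; exact: poly_growthZ.
- by apply: poly_growthD; [exact: poly_growthZ | exact: poly_growthM].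
rewrite (mexpD mt nu0 bD (f := fun y => - k * g y)); last 2 first.
- exact: poly_growthZ.
- exact: poly_growthM.
by rewrite !Eaff // (mexpZ mt nu0 _ bD) //; ring.
Qed.

Local Notation u a := (fun y => t y a 0 - eta nu t h a).

Lemma poly_growth_centered a : poly_growth (u a).
Proof.
apply: poly_growthD; first exact: poly_growth_coord.
exact: poly_growth_cst.
Qed.

Lemma mcov_centered a b : mcov (u a) (u b) = fisher nu t h a b.
Proof.
rewrite /mcov -/(fisher nu t h a b) (_ : E (u a) = 0) ?mul0r ?subr0 //.
rewrite (mexpD mt nu0 bD) ?(mexp_cst mt nu0 _ bD) ?subrr //.
- exact: poly_growth_coord.
- exact: poly_growth_cst.
Qed.

Lemma mcov_centered2 a b c d :
  mcov (fun y => u a y * u b y) (fun y => u c y * u d y) =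
  kurt nu t h a b c d - fisher nu t h a b * fisher nu t h c d.
Proof.
rewrite /mcov; congr (_ - _); rewrite /kurt; congr (mexp _ _ _ _).
by apply/funext => y; rewrite mulrA.
Qed.

Lemma measurable_dens : measurable_fun setT (dens nu t h).
Proof.
apply: measurableT_comp => //; apply: measurable_funD => //.
exact: measurable_dotc.
Qed.

End model_covariance.

(** * Passing from i.i.d. samples to the model density *)

Section iid_sample.
Context {R : realType} {dY : measure_display} {Y : measurableType dY}.
Context {dO : measure_display} {Omega : measurableType dO}.
Variable P : probability Omega R.

Lemma has_mean_law (nu : {measure set Y -> \bar R}) (X : Omega -> Y) (g f : Y -> R) :
  measurable_fun setT X -> measurable_fun setT g -> (forall y, 0 <= g y) ->
  (forall A, measurable A -> P (X @^-1` A) = (\int[nu]_(y in A) (g y)%:E)%E) ->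
  measurable_fun setT f ->
  nu.-integrable setT (EFin \o (fun y => f y * g y)) ->
  has_mean P (fun w => f (X w)) (fine (\int[nu]_y (f y * g y)%:E)%E).
Proof.
move=> mX mg g0 law mf ifg.
pose rX : {mfun Omega >-> Y} := HB.pack X (isMeasurableFun.Build _ _ _ _ _ mX).
have id := integrable_density mg g0 (mu' := distribution P rX) law mf ifg.
have e := integral_density mg g0 (mu' := distribution P rX) law mf ifg.
have iP : P.-integrable setT (EFin \o (fun w => f (X w))).
  have /integrableP[mm im] := id; apply/integrableP; split.
    by apply/measurable_EFinP; exact: measurableT_comp.
  move: im; rewrite ge0_integral_distribution //.
  exact: measurableT_comp.
split=> //; rewrite fineK; last exact: integrable_fin_num ifg.
by rewrite -e integral_distribution //; exact/measurable_EFinP.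
Qed.

Lemma indep_pair N (Ys : 'I_N -> Omega -> Y) :
  (forall A : 'I_N -> set Y, (forall i, measurable (A i)) ->
     P [set w | forall i, A i (Ys i w)] =
     (\prod_(i < N) fine (P (Ys i @^-1` A i)))%:E) ->
  (forall i, measurable_fun setT (Ys i)) ->
  forall i j, i != j -> forall A B, measurable A -> measurable B ->
  P (Ys i @^-1` A `&` Ys j @^-1` B) = (P (Ys i @^-1` A) * P (Ys j @^-1` B))%E.
Proof.
move=> indep mYs i j ij A B mA mB.
(* Taking the whole space for every other index turns those factors into 1, so mutual independence
   yields pairwise independence. *)
pose C k := if k == i then A else if k == j then B else setT.
have mC k : measurable (C k) by rewrite /C; case: ifP => // _; case: ifP.
have Ci : C i = A by rewrite /C eqxx.
have Cj : C j = B by rewrite /C eq_sym (negbTE ij) eqxx.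
have mP k S : measurable S -> measurable (Ys k @^-1` S).
  by move=> mS; rewrite -[X in measurable X]setTI; exact: mYs.
have -> : Ys i @^-1` A `&` Ys j @^-1` B = [set w | forall k, C k (Ys k w)].
  apply/seteqP; split=> [w [Aw Bw] k|w Cw].
    by rewrite /C; case: eqP => [->|_] //; case: eqP => [->|_].
  by split; [have := Cw i; rewrite Ci | have := Cw j; rewrite Cj].
rewrite indep // (bigD1 i) //= (bigD1 j) ?(eq_sym j) //= big1 ?mulr1; last first.
  move=> k /andP[/negbTE ki /negbTE kj].
  by rewrite /C ki kj preimage_setT probability_setT.
by rewrite Ci Cj EFinM !fineK // fin_num_measure //; exact: mP.
Qed.

Variables (nu : {measure set Y -> \bar R}) (m : nat) (t : Y -> 'cV[R]_m).
Hypothesis mt : forall a, measurable_fun setT (fun y => t y a 0).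
Hypothesis nu0 : nu setT <> 0%E.
Variables (h : 'cV[R]_m) (D : R).
Hypothesis bD : in_box nu t h D.
Variables (N : nat) (Ys : 'I_N -> Omega -> Y).
Hypothesis N0 : (0 < N)%N.
Hypothesis mYs : forall i, measurable_fun setT (Ys i).
Hypothesis law : forall i (A : set Y), measurable A ->
  P (Ys i @^-1` A) = (\int[nu]_(y in A) (dens nu t h y)%:E)%E.
Hypothesis indep : forall A : 'I_N -> set Y, (forall i, measurable (A i)) ->
  P [set w | forall i, A i (Ys i w)] =
  (\prod_(i < N) fine (P (Ys i @^-1` A i)))%:E.

(** Polynomial growth of [f], [g] and [f * g] gives all the means that [covariance_mean] asks for;
    the off-diagonal ones come from pairwise independence of the samples. *)
Lemma covariance_sample_mean f g : poly_growth t f -> poly_growth t g ->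
  covariance P (fun w => N%:R^-1 * \sum_i f (Ys i w))
               (fun w => N%:R^-1 * \sum_i g (Ys i w)) =
  (N%:R^-1 * mcov nu t h f g)%:E.
Proof.
move=> pf pg.
have hm i u : poly_growth t u -> has_mean P (fun w => u (Ys i w)) (mexp nu t h u).
  move=> pu; apply: has_mean_law => //.
  - exact: measurable_dens.
  - by move=> y; exact: expR_ge0.
  - exact: law.
  - by case: pu.
  - exact: (integrable_dens mt nu0 bD pu).
apply: covariance_mean => // [i|i|i|i j ij]; try exact: hm.
- exact: (hm i (fun y => f y * g y) (poly_growthM pf pg)).
- apply: has_mean_indep; [|exact: hm|exact: hm] => A B mA mB.
  have mpre u : poly_growth t u -> forall S, measurable S -> measurable (u @^-1` S).
    by move=> [mu _] S mS; rewrite -[X in measurable X]setTI; exact: mu.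
  exact: (indep_pair indep mYs ij (mpre _ pf _ mA) (mpre _ pg _ mB)).
Qed.

End iid_sample.

(** The covariances of the estimators are shown to be real numbers, so [fine] discards nothing. *)
Theorem mainTheorem19
  (R : realType) (L : nat) (n : nat -> nat)
  (HL : (1 <= L)%N) (Hn : forall l, (1 <= l <= L)%N -> (1 <= n l)%N)
  (x : 'cV[R]_(n 0)) (sigma : R -> R) (Hsigma : forall z, derivable sigma z 1)
  (dY : measure_display) (Y : measurableType dY) (nu : {measure set Y -> \bar R})
  (t : Y -> 'cV[R]_(n L)) (Ht : forall a, measurable_fun setT (fun y => t y a 0))
  (theta : pidx L n -> R)
  (Hint : interior (natparam nu t) (hL sigma x theta))
  (dO : measure_display) (Omega : measurableType dO) (P : probability Omega R)
  (N : nat) (HN : (0 < N)%N) (Ys : 'I_N -> Omega -> Y)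
  (HYm : forall i, measurable_fun setT (Ys i))
  (Hlaw : forall i (A : set Y), measurable A ->
     P (Ys i @^-1` A) = (\int[nu]_(y in A) (dens nu t (hL sigma x theta) y)%:E)%E)
  (Hindep : forall A : 'I_N -> set Y, (forall i, measurable (A i)) ->
     P [set w | forall i, A i (Ys i w)] = (\prod_(i < N) fine (P (Ys i @^-1` A i)))%:E) :
  let h := hL sigma x theta in
  ninf4 (fun p q r s => fine (covariance P (I1hat sigma x nu t theta Ys p q)
                                          (I1hat sigma x nu t theta Ys r s)))
    <= N%:R^-1 * ninf2 (jacL sigma x theta) ^+ 4
       * none4 (fun a b c d => kurt nu t h a b c d - fisher nu t h a b * fisher nu t h c d)
  /\
  (C2 sigma ->
   ninf4 (fun p q r s => fine (covariance P (I2hat sigma x nu t theta Ys p q)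
                                           (I2hat sigma x nu t theta Ys r s)))
    <= N%:R^-1 * ninf3 (hessL sigma x theta) ^+ 2 * none2 (fisher nu t h)).
Proof.
move=> h.
have [D bD] := interior_natparam_box Hint.
have nu0 : nu setT <> 0%E.
  (* The law of one sample, which exists since [0 < N], has total mass 1; over a null base measure
     it would be 0. *)
  move=> nuT0; have := Hlaw (Ordinal HN) setT measurableT.
  rewrite preimage_setT probability_setT null_set_integral //; last first.
    by apply/measurable_EFinP; exact: measurable_dens.
  by move=> /eqP; rewrite onee_eq0.
have cov := covariance_sample_mean Ht nu0 bD HN HYm Hlaw Hindep.
pose J := jacL sigma x theta; pose H := hessL sigma x theta.
pose u a y := t y a 0 - eta nu t h a.
have pu a : poly_growth t (u a) by exact: poly_growth_centered.
have Ninv : 0 <= N%:R^-1 :> R by rewrite invr_ge0.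
split=> [|C2s].
(* The product of two scores is a single sum over pairs [ab], so the first estimator is a sample
   mean of a linear combination of products of centered statistics. *)
- have I1E p q : I1hat sigma x nu t theta Ys p q = fun w => N%:R^-1 *
      \sum_i \sum_(ab : 'I_(n L) * 'I_(n L))
        J ab.1 p * J ab.2 q * (u ab.1 (Ys i w) * u ab.2 (Ys i w)).
    apply/funext => w; rewrite /I1hat; congr (_ * _); apply: eq_bigr => i _.
    rewrite !(pderiv_loglik Hsigma Ht nu0 _ _ bD) mulr_suml.
    under eq_bigr do rewrite mulr_sumr.
    by rewrite pair_bigA; apply: eq_bigr => ab _; rewrite mulrACA.
  have pu2 (ab : 'I_(n L) * 'I_(n L)) : poly_growth t (fun y => u ab.1 y * u ab.2 y).
    exact: poly_growthM.
  pose F p q y := \sum_(ab : 'I_(n L) * 'I_(n L))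
    J ab.1 p * J ab.2 q * (u ab.1 y * u ab.2 y).
  have pF p q : poly_growth t (F p q) by exact: poly_growth_lincomb.
  apply: ninf4_le => [|p q r s].
    apply: mulr_ge0; last by rewrite /none4; do 4! (apply: sumr_ge0 => ? _).
    by apply: mulr_ge0 => //; apply: exprn_ge0; exact: ninf2_ge0.
  rewrite !I1E (cov (F p q) (F r s)) //= normrM (ger0_norm Ninv) -mulrA ler_wpM2l //.
  rewrite (mcov_lincomb Ht nu0 bD) // none4E.
  under eq_bigr do under eq_bigr do rewrite mcov_centered2.
  (* The coefficients are products of four Jacobian entries, whence the fourth power of the maximum
     norm. *)
  apply: (normr_sum2_le (c := fun ab cd => J ab.1 p * J ab.2 q * (J cd.1 r * J cd.2 s))).
  move=> ab cd; rewrite !normrM (_ : 4 = 2 + 2)%N // exprD !expr2.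
  have JJ a a' l l' : `|J a l| * `|J a' l'| <= ninf2 J * ninf2 J.
    by apply: ler_pM => //; exact: le_ninf2.
  by apply: ler_pM; rewrite ?mulr_ge0 ?JJ.
(* Choice fixes the [y]-free constants of all second derivatives at once, so that [F] is a fixed
   family of statistics. *)
- have /choice[k kE] : forall pq : pidx L n * pidx L n, exists k, forall y,
      pderiv (fun th => pderiv (fun th' => loglik sigma x nu t th' y) th pq.2)
        theta pq.1 = \sum_a H a pq.1 pq.2 * u a y - k.
    by move=> pq; exact: pderiv2_loglik bD.
  pose F p q y := k (p, q) - \sum_a H a p q * u a y.
  have pS p q : poly_growth t (fun y => \sum_a H a p q * u a y).
    exact: poly_growth_lincomb.
  have pF p q : poly_growth t (F p q).
    have := poly_growthD (poly_growth_cst t (k (p, q))) (poly_growthZ (-1) (pS p q)).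
    by rewrite /F; under [in X in X -> _]eq_fun do rewrite mulN1r.
  have I2E p q : I2hat sigma x nu t theta Ys p q =
      fun w => N%:R^-1 * \sum_i F p q (Ys i w).
    apply/funext => w; rewrite /I2hat; congr (_ * _); apply: eq_bigr => i _.
    by rewrite (kE (p, q)) opprB.
  apply: ninf4_le => [|p q r s].
    apply: mulr_ge0; last by rewrite /none2; do 2! (apply: sumr_ge0 => ? _).
    by apply: mulr_ge0 => //; apply: exprn_ge0; exact: ninf3_ge0.
  rewrite !I2E cov //= normrM (ger0_norm Ninv) -mulrA ler_wpM2l //.
  rewrite (mcov_shift Ht nu0 bD) // (mcov_lincomb Ht nu0 bD) //.
  under eq_bigr do under eq_bigr do rewrite (mcov_centered Ht nu0 bD).
  (* Here the coefficients are products of two second derivatives, whence the square. *)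
  apply: (normr_sum2_le (c := fun a b => H a p q * H b r s)) => a b.
  by rewrite normrM expr2 ler_pM //; exact: le_ninf3.
Qed.
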